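(* Consider the system $\dot x=f(x)+Bw$, $z=Cx$ with the standing assumptions below, and a finite set of matrices $\mathcal A=\{A_1,\dots,A_k\}\subset\mathbb{R}^{n\times n}$ such that $\partial f(x)\in\operatorname{conv}\mathcal A$ for all $x\in\mathbb{R}^n$. Suppose $\eta_w,\eta_z\in\mathbb{R}$, $V\in\mathbb{R}^{n\times m}$, $P\in\mathbb{R}^{m\times 2n_w}$, and $M_1,\dots,M_k\in\mathbb{R}^{m\times m}$ satisfy (i) $P\ge 0$, $[B,\,-B]=VP$, $\eta_w\mathbf 1^T=\mathbf 1^TP$; (ii) $\eta_z>0$ and, for every $i\in\{1,\dots,k\}$: all off-diagonal entries of $M_i$ are nonnegative, $A_iV=VM_i$, and $-\eta_z\hat z_V=\mathbf 1^TM_i$, where $\hat z_V=[\,|CV_1|_1,\dots,|CV_m|_1\,]$ is the row vector whose $j$-th entry is the 1-norm of $C$ times the $j$-th column $V_j$ of $V$; and suppose the convex hull of the columns of $V$ is compact with $0$ in its interior. Let $\psi=\psi_{\mathcal V}/\eta_z$ and $\gamma_1=\eta_w/\eta_z$. Then for all $x_1,x_2\in\mathbb{R}^n$ and $w_1,w_2\in\mathbb{R}^{n_w}$, $$D^+\psi\big(x_1-x_2;\ f(x_1)-f(x_2)+B(w_1-w_2)\big)\le -|C(x_1-x_2)|_1+\gamma_1|w_1-w_2|_1,$$ and consequently the incremental $\mathcal L_1$ gain of the system is at most $\eta_w/\eta_z$: for any two inputs $w_1,w_2$ with $w_1-w_2\in\mathcal L_1$, the corresponding outputs (from $x_1(0)=x_2(0)=0$)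 satisfy $\|z_1-z_2\|_1\le (\eta_w/\eta_z)\|w_1-w_2\|_1$.
   Context: Standing assumptions: $f:\mathbb{R}^n\to\mathbb{R}^n$ is continuously differentiable with Jacobian $\partial f(x)$; $B\in\mathbb{R}^{n\times n_w}$, $C\in\mathbb{R}^{n_z\times n}$; every input signal $w$ yields a solution defined for all $t\ge0$ with $x(0)=0$, and $z=Cx$. $\operatorname{conv}\mathcal A=\{\sum_i\lambda_iA_i:\lambda_i\ge0,\sum_i\lambda_i=1\}$. $\mathbf 1$ is the all-ones vector; inequalities on matrices/vectors are entrywise. $|v|_1=\sum_i|v_i|$; $\|w\|_1=\int_0^\infty|w(t)|_1dt$, and $w\in\mathcal L_1$ iff $\|w\|_1<\infty$. The polyhedral gauge function is $\psi_{\mathcal V}(x)=\min_{p}\{\mathbf 1^Tp : x=Vp,\ p\ge0\}=\max_h\{h^Tx: h^TV\le\mathbf 1^T\}$. For a convex function $\psi$, $D^+\psi(x;v)=\lim_{h\downarrow0}(\psi(x+hv)-\psi(x))/h$ is its directional derivative at $x$ in direction $v$. *)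

(* Defs.v *)
From HB Require Import structures.
From mathcomp Require Import all_boot all_order all_algebra.
From mathcomp Require Import all_classical all_reals all_analysis.
Set Implicit Arguments. Unset Strict Implicit. Unset Printing Implicit Defensive.
Import Order.TTheory GRing.Theory Num.Theory.
Import numFieldNormedType.Exports.
Local Open Scope classical_set_scope.
Local Open Scope ring_scope.

Definition norm1 {R : realType} {n : nat} (v : 'cV[R]_n) : R :=
  \sum_(i < n) `|v i 0|.

(* Jacobian of f : R^n -> R^n at x (column convention: df(x) v = Jac f x *m v).
   The library's [jacobian] is for row vectors with v *m J; we transpose. *)
Definition Jac {R : realType} {n : nat} (f : 'cV[R]_n -> 'cV[R]_n) (x : 'cV[R]_n)
  : 'M[R]_n :=
  (jacobian (fun r : 'rV[R]_n => (f r^T)^T) x^T)^T.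

Definition C1 {R : realType} {n : nat} (f : 'cV[R]_n -> 'cV[R]_n) : Prop :=
  (forall x, differentiable f x) /\ continuous (Jac f).

Definition in_conv {R : realType} {n k : nat} (A : 'I_k -> 'M[R]_n) (X : 'M[R]_n)
  : Prop :=
  exists lam : 'I_k -> R, (forall i, 0 <= lam i) /\ \sum_(i < k) lam i = 1 /\
    X = \sum_(i < k) lam i *: A i.

Definition conv_cols {R : realType} {n m : nat} (V : 'M[R]_(n, m)) : set 'cV[R]_n :=
  [set x | exists p : 'cV[R]_m, (forall j, 0 <= p j 0) /\ \sum_(j < m) p j 0 = 1 /\
    x = V *m p].

Definition psiV {R : realType} {n m : nat} (V : 'M[R]_(n, m)) (x : 'cV[R]_n) : R :=
  inf [set \sum_(j < m) p j 0 | p in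
        [set p : 'cV[R]_m | (forall j, 0 <= p j 0) /\ x = V *m p]].

Definition Dplus {R : realType} {n : nat} (psi : 'cV[R]_n -> R) (x v : 'cV[R]_n) : R :=
  lim ((fun h : R => (psi (x + h *: v) - psi x) / h) @ 0^'+).

(* x is a (Carathéodory) solution of xdot = f(x) + B w on [0, oo) with x(0) = 0:
   for every t >= 0, the right-hand side is Lebesgue integrable on [0,t] and
   x(t) = int_0^t (f(x(s)) + B w(s)) ds (componentwise). *)
Definition is_solution {R : realType} {n nw : nat} (f : 'cV[R]_n -> 'cV[R]_n)
  (B : 'M[R]_(n, nw)) (w : R -> 'cV[R]_nw) (x : R -> 'cV[R]_n) : Prop :=
  forall t : R, 0 <= t -> forall i : 'I_n,
    (@lebesgue_measure R).-integrable `[0, t]%classic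
        (fun s => ((f (x s) + B *m w s) i 0)%:E) /\
    x t i 0 = Rintegral (@lebesgue_measure R) `[0, t]%classic
        (fun s => (f (x s) + B *m w s) i 0).

Definition halfline (R : realType) : set R := `[0, +oo[%classic.
Arguments halfline R : clear implicits.

(* Main.v *)
(* For e = x1 - x2, the increment f x1 - f x2 is A_lam e for some convex
   combination A_lam of the A_i. If e = V p with p >= 0, then
   e + h (A_lam e + B w) = V (p + h M_lam p + h P [w+; w-]), and the coefficients
   are nonnegative for all h <= h0, where h0 depends on the M_i only. Summing them
   bounds psiV (e + h (f x1 - f x2 + B w)) by
   psiV e - h eta_z |C e|_1 + h eta_w |w|_1, which gives the bound on Dplus.

   For the gain, the curve psiV (e t) is never differentiated. Over a short
   interval ]a, b], e b is e a + (b - a) (f (x1 a) - f (x2 a)) plus a small term,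
   because f (x1 s) - f (x2 s) is continuous in s, plus B times the integral of
   w1 - w2, whose gauge is at most eta_w times the integral of |w1 - w2|_1. Hence
   psiV (e t) + eta_z int_0^t |C e|_1 - eta_w int_0^t |w1 - w2|_1 increases by
   o(b - a) around every point, so it stays nonpositive. *)
Require Import Defs.
From HB Require Import structures.
From mathcomp Require Import all_boot all_order all_algebra.
From mathcomp Require Import all_classical all_reals all_analysis.
From mathcomp Require Import measurable_realfun ring lra.
Import Order.TTheory GRing.Theory Num.Theory.
Import numFieldNormedType.Exports.
Local Open Scope classical_set_scope.
Local Open Scope ring_scope.

(** * The gauge [psiV] as a finite, nonnegative, sublinear function *)

Section Gauge.
Context {R : realType} {n m : nat} (V : 'M[R]_(n, m)).

Lemma psiV_le_sum (p : 'cV[R]_m) :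
  (forall j, 0 <= p j 0) -> psiV V (V *m p) <= \sum_(j < m) p j 0.
Proof.
move=> p0; apply: ge_inf; last by exists p.
by exists 0 => _ [q [q0 _] <-]; exact: sumr_ge0.
Qed.

Hypothesis V0 : interior (conv_cols V) 0.

(** A ball of radius [r] about 0 lies in the hull, so [x] rescaled to norm [r / 2] is a convex
    combination of columns; scaling back multiplies the weights by [2 / r * |x|]. *)
Lemma conv_cols_absorbing : exists2 L : R, 0 < L &
  forall x, exists p : 'cV[R]_m,
    [/\ forall j, 0 <= p j 0, x = V *m p & \sum_(j < m) p j 0 <= L * `|x|].
Proof.
have /nbhs_ballP[r /= r0 rV] := V0.
exists (2 / r); first by rewrite divr_gt0.
move=> x; have [->|xN0] := eqVneq x 0.
  exists 0; split => [j||]; rewrite ?mxE ?mulmx0 //.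
  by rewrite normr0 mulr0 big1 // => j _; rewrite mxE.
have x0 : 0 < `|x| by rewrite normr_gt0.
have [|p [p0 [p1 xp]]] := rV ((r / 2 / `|x|) *: x).
  rewrite -ball_normE /ball_ /= sub0r normrN normrZ ger0_norm.
    by rewrite divfK ?gt_eqF// ltr_pdivrMr // ltr_pMr // ltr1n.
  by rewrite !divr_ge0 // ltW.
exists ((2 / r * `|x|) *: p); split.
- by move=> j; rewrite mxE mulr_ge0 // mulr_ge0 // divr_ge0 // ltW.
- rewrite -scalemxAr -xp scalerA -[LHS]scale1r; congr (_ *: _).
  by field; rewrite !gt_eqF.
- under eq_bigr do rewrite mxE.
  by rewrite -mulr_sumr p1 mulr1.
Qed.

Lemma psiV_feasible x : exists p : 'cV[R]_m, (forall j, 0 <= p j 0) /\ x = V *m p.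
Proof.
by have [L _ /(_ x)[p [p0 xp _]]] := conv_cols_absorbing; exists p.
Qed.

(** Feasibility of [x] matters: [inf] of the empty set is 0, which would break the bound for
    positive [c]. *)
Lemma le_psiV c x :
  (forall p : 'cV[R]_m, (forall j, 0 <= p j 0) -> x = V *m p ->
    c <= \sum_(j < m) p j 0) ->
  c <= psiV V x.
Proof.
move=> H; apply: lb_le_inf.
  by have [p ?] := psiV_feasible x; exists (\sum_(j < m) p j 0), p.
by move=> _ [p [p0 xp] <-]; exact: H.
Qed.

Lemma psiV_ge0 x : 0 <= psiV V x.
Proof. by apply: le_psiV => p p0 _; exact: sumr_ge0. Qed.

(** Representations of [x] and [y] add up to one of [x + y]; the two infima on the right are treated
    one after the other. *)
Lemma psiV_subadditive x y : psiV V (x + y) <= psiV V x + psiV V y.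
Proof.
rewrite -lerBlDl; apply: le_psiV => q q0 yq.
rewrite lerBlDl -lerBlDr; apply: le_psiV => p p0 xp.
rewrite lerBlDr -big_split /= xp yq -mulmxDr.
have -> : \sum_(j < m) (p j 0 + q j 0) = \sum_(j < m) (p + q) j 0.
  by apply: eq_bigr => j _; rewrite mxE.
by apply: psiV_le_sum => j; rewrite mxE addr_ge0.
Qed.

Lemma psiVZ_le h x : 0 <= h -> psiV V (h *: x) <= h * psiV V x.
Proof.
rewrite le_eqVlt => /predU1P[<-|h0].
  rewrite scale0r mul0r -(mulmx0 _ V); apply: le_trans (psiV_le_sum _ _) _.
    by move=> j; rewrite mxE.
  by rewrite big1 // => j _; rewrite mxE.
rewrite -ler_pdivrMl //; apply: le_psiV => p p0 ->.
rewrite ler_pdivrMl // mulr_sumr scalemxAr.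
have -> : \sum_(j < m) h * p j 0 = \sum_(j < m) (h *: p) j 0.
  by apply: eq_bigr => j _; rewrite mxE.
by apply: psiV_le_sum => j; rewrite mxE mulr_ge0 // ltW.
Qed.

Lemma psiV_le_norm : exists2 L : R, 0 < L & forall x, psiV V x <= L * `|x|.
Proof.
have [L L0 H] := conv_cols_absorbing; exists L => // x.
have [p [p0 xp pL]] := H x.
by apply: le_trans pL; rewrite {1}xp; exact: psiV_le_sum.
Qed.

Lemma psiV0 : psiV V 0 = 0.
Proof.
apply/le_anti; rewrite psiV_ge0 andbT.
by have := psiVZ_le 0 0 (lexx _); rewrite scale0r mul0r.
Qed.

End Gauge.

(** * One-sided directional derivatives of sublinear functions *)

Section DirectionalDerivative.
Context {R : realType} {n : nat} (psi : 'cV[R]_n -> R).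
Hypothesis psiD : forall x y, psi (x + y) <= psi x + psi y.
Hypothesis psiZ : forall h x, 0 <= h -> psi (h *: x) <= h * psi x.

(** Convexity: [x + h1 v] divides the segment from [x] to [x + h2 v] in the ratio [t = h1 / h2]. *)
Lemma sublinear_quotient_nondecreasing x v h1 h2 : 0 < h1 -> h1 <= h2 ->
  (psi (x + h1 *: v) - psi x) / h1 <= (psi (x + h2 *: v) - psi x) / h2.
Proof.
move=> h1_gt0 h12; have h2_gt0 := lt_le_trans h1_gt0 h12.
pose t := h1 / h2.
have t0 : 0 <= t by rewrite divr_ge0 // ltW.
have t1 : 0 <= 1 - t by rewrite subr_ge0 ler_pdivrMr // mul1r.
have E : x + h1 *: v = (1 - t) *: x + t *: (x + h2 *: v).
  by rewrite scalerDr addrA -scalerDl subrK scale1r scalerA divfK ?gt_eqF.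
have : psi (x + h1 *: v) <= (1 - t) * psi x + t * psi (x + h2 *: v).
  by rewrite E; apply: le_trans (psiD _ _) _; rewrite lerD ?psiZ.
rewrite ler_pdivrMr // => H.
have -> : (psi (x + h2 *: v) - psi x) / h2 * h1 = t * (psi (x + h2 *: v) - psi x).
  by rewrite /t; field; rewrite gt_eqF.
lra.
Qed.

(** A bound on the quotients passes to [lim] only once the limit is known to exist; existence
    follows from monotonicity and a lower bound. *)
Lemma Dplus_le x v c h0 : 0 < h0 ->
  (forall h, 0 < h -> h <= h0 -> psi (x + h *: v) <= psi x + h * c) ->
  Dplus psi x v <= c.
Proof.
move=> h0_gt0 H; rewrite /Dplus.
pose q h := (psi (x + h *: v) - psi x) / h.
have cq : cvg (q h @[h --> 0^'+]).
  apply/cvg_ex; exists (inf [set q h | h in [set` Interval (BRight 0) (BLeft h0)]]).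
  apply: nondecreasing_at_right_cvgr => //.
    move=> a b; rewrite !in_itv /= => /andP[a0 _] _ ab.
    exact: sublinear_quotient_nondecreasing.
  (* Lower bound from [psi x <= psi (x + h v) + h psi (- v)]. *)
  exists (- psi (- v)) => _ [h] + <-; rewrite set_itvE => /= /andP[h_gt0 _].
  rewrite /q ler_pdivlMr //.
  have := psiD (x + h *: v) (h *: - v).
  have := psiZ h (- v) (ltW h_gt0).
  rewrite scalerN addrK; lra.
apply: limr_le => //; near=> h.
have h_gt0 : 0 < h by near: h; exact: nbhs_right_gt.
have hh0 : h <= h0 by near: h; exact: nbhs_right_le.
by rewrite ler_pdivrMr // lerBlDl mulrC H.
Unshelve. all: by end_near. Qed.

End DirectionalDerivative.

(** * Jacobians acting on column vectors *)

Lemma continuous_trmx {R : realType} {p q : nat} :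
  continuous (trmx : 'M[R]_(p, q) -> 'M[R]_(q, p)).
Proof.
move=> N A /nbhs_ballP[e e0 eA]; apply/nbhs_ballP; exists e => // N' [_ NN'].
by apply: eA; split => // i j; rewrite !mxE; exact: NN'.
Qed.

(** [Jac] is defined through the conjugate of [f] by transposition, so the chain rule is applied
    through the two linear maps [trmx]. *)
Lemma diff_Jac {R : realType} {n : nat} (f : 'cV[R]_n -> 'cV[R]_n) (x v : 'cV[R]_n) :
  differentiable f x -> 'd f x v = Jac f x *m v.
Proof.
move=> df; apply: trmx_inj; rewrite trmx_mul trmxK.
pose F : 'rV[R]_n -> 'rV[R]_n := trmx \o (f \o trmx).
have dT p q (y : 'M[R]_(p, q)) : differentiable (trmx : 'M[R]_(p, q) -> 'M[R]_(q, p)) y.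
  by apply: linear_differentiable; exact: continuous_trmx.
have dft : differentiable (f \o trmx) x^T.
  by apply: differentiable_comp => //; rewrite trmxK.
have dF : differentiable F x^T by exact: differentiable_comp.
rewrite -[RHS](deriveEjacobian v^T dF) (deriveE _ dF).
have dfx : differentiable f x^T^T by rewrite trmxK.
rewrite (congr1 (@^~ v^T) (diff_comp dft (dT _ _ _))) /=.
rewrite (congr1 (@^~ v^T) (diff_comp (dT _ _ x^T) dfx)) /=.
rewrite (congr1 (@^~ v^T) (diff_lin x^T continuous_trmx)).
rewrite (congr1 (@^~ _) (diff_lin _ continuous_trmx)).
by rewrite /= !trmxK.
Qed.

Lemma is_derive_line {R : realType} {n : nat} (f : 'cV[R]_n -> 'cV[R]_n)
    (x v : 'cV[R]_n) (i : 'I_n) (s : R) :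
  (forall y, differentiable f y) ->
  is_derive s 1 (fun r : R => f (r *: v + x) i 0) ((Jac f (s *: v + x) *m v) i 0).
Proof.
move=> df.
pose c := fun y : 'cV[R]_n => y i 0.
(* The coordinate map [c], bundled as a linear map so that [diff_lin] gives its differential. *)
have @cl : {linear 'cV[R]_n -> R}.
  by exists c; do 2![eexists]; do ?[constructor];
     rewrite /c ?mxE// => ? *; rewrite ?mxE//; move=> ?; rewrite !mxE.
pose l := (fun r : R => r *: v + x).
have ls : is_diff s l (fun r : R => r *: v).
  by apply: is_diff_eq; rewrite addr0.
have dl : differentiable l s by apply: ex_diff.
have dfl : differentiable (f \o l) s by exact: differentiable_comp.
have dc y : differentiable c y by exact: differentiable_coord.
have dcfl : differentiable (c \o (f \o l)) s by exact: differentiable_comp.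
apply: DeriveDef; first exact: diff_derivable.
rewrite (deriveE _ dcfl).
rewrite (congr1 (@^~ 1) (diff_comp dfl (dc _))) /=.
rewrite (congr1 (@^~ 1) (diff_comp dl (df _))) /=.
rewrite (_ : 'd l s 1 = v); last by rewrite diff_val scale1r.
rewrite diff_Jac //.
have cc : continuous cl by exact: coord_continuous.
by rewrite (congr1 (@^~ _) (diff_lin _ cc)).
Qed.

(** * Convex hulls of finitely many points and a vector-valued mean value theorem *)

Section ClosestPoint.
Context {R : realType} {n k : nat} (a : 'I_k -> 'cV[R]_n) (q : 'cV[R]_n).

Let simplex : set 'rV[R]_k :=
  [set lam | (forall i, 0 <= lam 0 i) /\ \sum_(i < k) lam 0 i = 1].

(** Squared Euclidean distance from [q] to the hull point with weights [lam]; the argument expands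
    it through the inner product. *)
Let dist2 (lam : 'rV[R]_k) : R :=
  \sum_(j < n) (q j 0 - \sum_(i < k) lam 0 i * a i j 0) ^+ 2.

Let simplex_compact : compact simplex.
Proof.
apply: (@subclosed_compact _ _ [set lam : 'rV[R]_k | forall i, `[0, 1]%classic (lam 0 i)]).
- rewrite (_ : simplex =
    \bigcap_(i in [set: 'I_k]) ((fun lam : 'rV[R]_k => lam 0 i) @^-1` [set x | 0 <= x])
    `&` (fun lam : 'rV[R]_k => \sum_(i < k) lam 0 i) @^-1` [set x | x = 1]); last first.
    apply/seteqP; split => lam /= [H1 H2]; split => // i; last exact: H1.
    by move=> _; exact: H1.
  apply: closedI.
    apply: closed_bigI => i _; apply: closed_comp; last exact: closed_ge.
    by move=> ? _; exact: coord_continuous.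
  apply: closed_comp; last exact: closed_eq.
  move=> ? _; apply: continuous_big => [|i _]; first exact: add_continuous.
  exact: coord_continuous.
- by apply: (@rV_compact R k (fun=> `[0, 1]%classic)) => i; exact: segment_compact.
- move=> lam [lam0 lam1] i /=; rewrite in_itv /= lam0 /= -lam1 (bigD1 i) //=.
  by rewrite lerDl sumr_ge0.
Qed.

Let dist2_continuous : continuous dist2.
Proof.
apply: continuous_big => [|j _]; first exact: add_continuous.
have H : continuous (fun lam : 'rV[R]_k => q j 0 - \sum_(i < k) lam 0 i * a i j 0).
  move=> lam; apply: (@continuousB _ _ _ (cst (q j 0))); first exact: cst_continuous.
  apply: continuous_big lam => [|i _]; first exact: add_continuous.
  by move=> lam; apply: continuousM; [exact: coord_continuous|exact: cst_continuous].
by move=> lam; exact: (continuousM (H lam) (H lam)).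
Qed.

(* Apply the hypothesis to u = q - y, where y is the point of the convex hull
   closest to q: the hull point z it provides satisfies <u, z - y> = |u|^2, so
   moving from y towards z would decrease the distance unless u = 0. *)
Lemma mem_conv_of_functionals :
  (forall u : 'I_n -> R, exists lam : 'I_k -> R,
    [/\ forall i, 0 <= lam i, \sum_(i < k) lam i = 1 &
      \sum_(j < n) u j * q j 0 = \sum_(j < n) u j * (\sum_(i < k) lam i *: a i) j 0]) ->
  exists lam : 'I_k -> R,
    [/\ forall i, 0 <= lam i, \sum_(i < k) lam i = 1 & q = \sum_(i < k) lam i *: a i].
Proof.
move=> H.
have row_simplex lam : (forall i, 0 <= lam i) -> \sum_(i < k) lam i = 1 ->
    simplex (\row_i lam i).
  by move=> lam0 lam1; split => [i|]; [rewrite mxE|under eq_bigr do rewrite mxE].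
have [||lam] := @EVT_min_rV R k dist2 simplex _ simplex_compact.
(* The zero functional already shows that the simplex is nonempty. *)
- by have [lam [lam0 lam1 _]] := H (fun=> 0); exists (\row_i lam i); exact: row_simplex.
- exact: continuous_subspaceT.
rewrite inE => -[lam0 lam1] lam_min.
pose y j := \sum_(i < k) lam 0 i * a i j 0.
pose u j := q j 0 - y j.
have [mu [mu0 mu1 muE]] := H u.
pose z j := \sum_(i < k) mu i * a i j 0.
have zE j : (\sum_(i < k) mu i *: a i) j 0 = z j.
  by rewrite summxE; apply: eq_bigr => i _; rewrite mxE.
pose D := \sum_(j < n) u j ^+ 2.
pose W := \sum_(j < n) (z j - y j) ^+ 2.
have D0 : 0 <= D by apply: sumr_ge0 => j _; exact: sqr_ge0.
have W0 : 0 <= W by apply: sumr_ge0 => j _; exact: sqr_ge0.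
have uzy : \sum_(j < n) u j * (z j - y j) = D.
  under eq_bigr do rewrite mulrBr.
  rewrite sumrB -(eq_bigr _ (fun j _ => congr1 _ (zE j))) -muE -sumrB.
  by apply: eq_bigr => j _; rewrite -mulrBr expr2.
(* Minimality of [y] against [(1 - t) y + t z], whose squared distance to [q] expands with
   [<u, z - y> = D]. *)
have min_t t : 0 <= t -> t <= 1 -> D <= D - 2 * t * D + t ^+ 2 * W.
  move=> t0 t1.
  have : (\row_i ((1 - t) * lam 0 i + t * mu i)) \in simplex.
    rewrite inE; apply: row_simplex => [i|].
      by rewrite addr_ge0 // mulr_ge0 // subr_ge0.
    by rewrite big_split /= -!mulr_sumr lam1 mu1 !mulr1 subrK.
  move=> /lam_min; rewrite /dist2.
  have -> : \sum_(j < n) (q j 0 - \sum_(i < k) lam 0 i * a i j 0) ^+ 2 = D by [].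
  move=> /le_trans; apply.
  rewrite -[in 2 * t * D]uzy /D /W !mulr_sumr -sumrB -big_split /=.
  apply: ler_sum => j _; rewrite le_eqVlt; apply/orP; left; apply/eqP.
  under eq_bigr do rewrite mxE mulrDl -!mulrA.
  rewrite big_split /= -!mulr_sumr -/(y j) -/(z j) /u; ring.
have D_eq0 : D = 0.
  apply/eqP; rewrite eq_le D0 andbT leNgt; apply/negP => D_gt0.
  have DW : 0 < D + W by rewrite ltr_pwDl.
  (* The step [t = D / (D + W)] lies in [[0, 1]] even when [W = 0], and strictly decreases the
     distance if [D > 0]. *)
  have t0 : 0 <= D / (D + W) by rewrite divr_ge0 // ltW.
  have t1 : D / (D + W) <= 1 by rewrite ler_pdivrMr // mul1r lerDl.
  have := min_t _ t0 t1.
  have -> : D - 2 * (D / (D + W)) * D + (D / (D + W)) ^+ 2 * W =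
    D - D ^+ 2 * (2 * D + W) / (D + W) ^+ 2 by field; rewrite gt_eqF.
  rewrite lerBrDr gerDl leNgt => /negP; apply.
  by rewrite divr_gt0 ?exprn_gt0 // mulr_gt0 ?exprn_gt0 // ltr_pwDl // mulr_gt0.
exists (lam 0); split => //; apply/matrixP => j l; rewrite (ord1 l) summxE.
have /eqP : u j ^+ 2 = 0.
  by apply: (psumr_eq0P _ D_eq0) => // i _; exact: sqr_ge0.
rewrite sqrf_eq0 subr_eq0 => /eqP ->.
by apply: eq_bigr => i _; rewrite mxE.
Qed.

End ClosestPoint.

(** The scalar mean value theorem along the segment, applied to [<u, f>], gives an intermediate
    point and weights that depend on [u]; [mem_conv_of_functionals] turns them into weights valid
    for the whole vector. *)
Lemma increment_in_conv {R : realType} {n k : nat} (f : 'cV[R]_n -> 'cV[R]_n)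
    (A : 'I_k -> 'M[R]_n) (x1 x2 : 'cV[R]_n) :
  (forall x, differentiable f x) -> (forall x, in_conv A (Jac f x)) ->
  exists lam : 'I_k -> R, [/\ forall i, 0 <= lam i, \sum_(i < k) lam i = 1 &
    f x1 - f x2 = \sum_(i < k) lam i *: (A i *m (x1 - x2))].
Proof.
move=> df convA; apply: mem_conv_of_functionals => u.
set v := x1 - x2.
pose g (r : R) : R := \sum_(j < n) u j * f (r *: v + x2) j 0.
pose dg (r : R) : R := \sum_(j < n) u j * (Jac f (r *: v + x2) *m v) j 0.
have gd (r : R) : is_derive r 1 g (dg r).
  have -> : g = \sum_(j < n) (u j \*: (fun r : R => f (r *: v + x2) j 0 : R)).
    by apply/funext => r'; rewrite fct_sumE.
  by apply: is_derive_sum => j; apply: is_deriveZ; exact: is_derive_line.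
have [|c _] := @MVT R g dg 0 1 ltr01 (fun r _ => gd r).
  apply: continuous_subspaceT => r; apply: differentiable_continuous.
  by apply/derivable1_diffP; apply: ex_derive.
rewrite /g subr0 mulr1 scale0r scale1r add0r subrK -sumrB => gc.
have [lam [lam0 [lam1 JE]]] := convA (c *: v + x2).
exists lam; split => //.
transitivity (dg c).
  by rewrite -gc; apply: eq_bigr => j _; rewrite -mulrBr !mxE.
apply: eq_bigr => j _; rewrite JE mulmx_suml; congr (_ * _).
by rewrite !summxE; apply: eq_bigr => i _; rewrite scalemxAl.
Qed.

(** * The 1-norm *)

Section Norm1.
Context {R : realType} {n : nat}.
Implicit Types x y : 'cV[R]_n.

Lemma norm1_ge0 x : 0 <= norm1 x.
Proof. exact: sumr_ge0. Qed.

Lemma norm1D x y : norm1 (x + y) <= norm1 x + norm1 y.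
Proof.
by rewrite /norm1 -big_split; apply: ler_sum => i _; rewrite mxE ler_normD.
Qed.

Lemma norm1Z (h : R) x : norm1 (h *: x) = `|h| * norm1 x.
Proof.
by rewrite /norm1 mulr_sumr; apply: eq_bigr => i _; rewrite mxE normrM.
Qed.

Lemma norm1_sum (I : finType) (F : I -> 'cV[R]_n) :
  norm1 (\sum_i F i) <= \sum_i norm1 (F i).
Proof.
elim/big_ind2: _ => // [|x a y b xa yb].
  by rewrite /norm1 big1 // => i _; rewrite mxE normr0.
exact: le_trans (norm1D _ _) (lerD xa yb).
Qed.

Lemma const1_mul x : ((const_mx 1 : 'rV[R]_n) *m x) 0 0 = \sum_(j < n) x j 0.
Proof. by rewrite mxE; apply: eq_bigr => j _; rewrite mxE mul1r. Qed.

End Norm1.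

(** * Dissipation inequality from the matrix conditions *)

Section Dissipation.
Context {R : realType} {n nw nz m k : nat}.
Variables (f : 'cV[R]_n -> 'cV[R]_n) (B : 'M[R]_(n, nw)) (C : 'M[R]_(nz, n)).
Variables (A : 'I_k -> 'M[R]_n) (eta_w eta_z : R) (V : 'M[R]_(n, m)).
Variables (P : 'M[R]_(m, nw + nw)) (M : 'I_k -> 'M[R]_m).
Hypothesis P_ge0 : forall j l, 0 <= P j l.
Hypothesis BVP : row_mx B (- B) = V *m P.
Hypothesis PE : eta_w *: (const_mx 1 : 'rV[R]_(nw + nw)) = (const_mx 1 : 'rV[R]_m) *m P.
Hypothesis M_ge0 : forall i : 'I_k, forall j l : 'I_m, j != l -> 0 <= M i j l.
Hypothesis AVM : forall i : 'I_k, A i *m V = V *m M i.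
Hypothesis ME : forall i : 'I_k,
  - eta_z *: (\row_(j < m) norm1 (C *m col j V)) = (const_mx 1 : 'rV[R]_m) *m M i.
Hypothesis eta_z_ge0 : 0 <= eta_z.
Hypothesis V0 : interior (conv_cols V) 0.

(** With the positive and negative parts of [u] stacked, [B u = [B, -B] [u+; u-] = V P [u+; u-]].
    The coefficients are nonnegative and their sum is [eta_w] times the sum of the entries of [u+]
    and [u-]. *)
Lemma psiV_input (u : 'cV[R]_nw) : psiV V (B *m u) <= eta_w * norm1 u.
Proof.
pose a : 'cV[R]_nw := \col_i Num.max (u i 0) 0.
pose b : 'cV[R]_nw := \col_i Num.max (- u i 0) 0.
have Bu : B *m u = V *m (P *m col_mx a b).
  rewrite mulmxA -BVP mul_row_col mulNmx -mulmxBr; congr (_ *m _).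
  apply/matrixP => i j; rewrite !mxE (ord1 j).
  by case: (leP (u i 0) 0); case: (leP (- u i 0) 0); lra.
have -> : eta_w * norm1 u = \sum_(j < m) (P *m col_mx a b) j 0.
  rewrite -const1_mul mulmxA -PE -scalemxAl mxE const1_mul big_split_ord /=.
  congr (_ * _); rewrite -big_split /=; apply: eq_bigr => i _.
  rewrite col_mxEu col_mxEd !mxE.
  by case: (leP (u i 0) 0); case: (leP (- u i 0) 0) => *;
    [rewrite ler0_norm//; lra|rewrite ler0_norm//; lra
    |rewrite gtr0_norm//; lra|lra].
rewrite Bu; apply: psiV_le_sum => j; rewrite mxE; apply: sumr_ge0 => l _.
rewrite mulr_ge0 //; case: (split_ordP l) => i ->.
  by rewrite col_mxEu mxE le_max lexx orbT.
by rewrite col_mxEd mxE le_max lexx orbT.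
Qed.

Lemma diag_step : exists2 h0 : R, 0 < h0 &
  forall h i j, 0 <= h -> h <= h0 -> 0 <= 1 + h * M i j j.
Proof.
(* [S] dominates every diagonal entry, so one step size serves all [i] and [j]; adding 1 before
   inverting covers [S = 0]. *)
pose S : R := \sum_i \sum_j `|M i j j|.
have S0 : 0 <= S by apply: sumr_ge0 => i _; exact: sumr_ge0.
have S1 : 0 < 1 + S by rewrite ltr_pwDl.
exists (1 + S)^-1; first by rewrite invr_gt0.
move=> h i j h_ge0 hS.
have MS : `|M i j j| <= S.
  rewrite /S (bigD1 i) //= (bigD1 j) //= -addrA lerDl addr_ge0 ?sumr_ge0 //.
  by move=> *; exact: sumr_ge0.
have hM : `|h * M i j j| <= 1.
  rewrite normrM ger0_norm //; apply: le_trans (ler_wpM2l h_ge0 MS) _.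
  apply: le_trans (ler_wpM2r S0 hS) _.
  by rewrite mulrC ler_pdivrMr // mul1r lerDr.
by move: hM; rewrite ler_norml => /andP[+ _]; rewrite -lerBlDl sub0r.
Qed.

(* With e = V p, the Euler step e + h A_lam e equals V (p + h M_lam p), whose
   coefficients stay nonnegative as soon as 1 + h (M_i)_jj >= 0 for all i, j. *)
Lemma psiV_drift : exists2 h0 : R, 0 < h0 &
  forall (lam : 'I_k -> R) (e : 'cV[R]_n) h,
    (forall i, 0 <= lam i) -> \sum_(i < k) lam i = 1 -> 0 <= h -> h <= h0 ->
    psiV V (e + h *: \sum_(i < k) lam i *: (A i *m e)) <=
      psiV V e - h * (eta_z * norm1 (C *m e)).
Proof.
have [h0 h0_gt0 Hdiag] := diag_step; exists h0 => // lam e h lam0 lam1 h_ge0 hh0.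
rewrite lerBrDr; apply: le_psiV => // p p0 eVp; rewrite -lerBrDr.
pose q := p + h *: \sum_(i < k) lam i *: (M i *m p).
have Vq : e + h *: \sum_(i < k) lam i *: (A i *m e) = V *m q.
  rewrite /q mulmxDr -eVp -scalemxAr mulmx_sumr; congr (_ + _ *: _).
  apply: eq_bigr => i _.
  by rewrite -scalemxAr mulmxA -AVM -mulmxA -eVp.
(* Since the weights sum to 1, [q] is a convex combination of the vectors [p + h M_i p], and
   nonnegativity can be checked for each [i] separately. *)
have qE : q = \sum_(i < k) lam i *: (p + h *: (M i *m p)).
  under eq_bigr do rewrite scalerDr.
  rewrite big_split /= -scaler_suml lam1 scale1r /q scaler_sumr.
  by congr (_ + _); apply: eq_bigr => i _; rewrite !scalerA mulrC.
have q0 j : 0 <= q j 0.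
  rewrite qE summxE; apply: sumr_ge0 => i _; rewrite !mxE mulr_ge0 //.
  rewrite (bigD1 j) //= mulrDr addrA mulrA -[X in X + _ + _]mul1r -mulrDl.
  rewrite addr_ge0 ?mulr_ge0 ?Hdiag // sumr_ge0 // => l lj.
  by rewrite mulr_ge0 // M_ge0 // eq_sym.
rewrite Vq; apply: le_trans (psiV_le_sum V q q0) _.
pose s := \sum_(j < m) norm1 (C *m col j V) * p j 0.
(* The column sums of [M_i] are the same for every [i], so the weights [lam] disappear. *)
have -> : \sum_(j < m) q j 0 = \sum_(j < m) p j 0 - h * (eta_z * s).
  rewrite -(const1_mul q) /q mulmxDr mxE const1_mul; congr (_ + _).
  rewrite -scalemxAr mxE -mulrN; congr (_ * _).
  rewrite mulmx_sumr summxE.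
  under eq_bigr do rewrite -scalemxAr mulmxA -ME -scalemxAl !mxE.
  rewrite -mulr_suml lam1 mul1r mulNr; congr (- (_ * _)).
  by apply: eq_bigr => j _; rewrite mxE.
(* It remains to see that [s] dominates [|C e|_1]: the triangle inequality for [C e], the sum of the
   [p_j C V_j]. *)
rewrite lerD2l lerN2 ler_wpM2l // ler_wpM2l //.
rewrite eVp mulmxA (_ : C *m V *m p = \sum_(j < m) p j 0 *: (C *m col j V)).
  apply: le_trans (norm1_sum _ _) _; apply: ler_sum => j _.
  by rewrite norm1Z ger0_norm // mulrC.
apply/matrixP => i j; rewrite mxE summxE (ord1 j); apply: eq_bigr => l _.
rewrite !mxE mulrC; congr (_ * _); apply: eq_bigr => r _; by rewrite !mxE.
Qed.

Hypothesis f_diff : forall x, differentiable f x.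
Hypothesis f_conv : forall x, in_conv A (Jac f x).

Lemma psiV_euler : exists2 h0 : R, 0 < h0 &
  forall (x1 x2 : 'cV[R]_n) h, 0 <= h -> h <= h0 ->
    psiV V (x1 - x2 + h *: (f x1 - f x2)) <=
      psiV V (x1 - x2) - h * (eta_z * norm1 (C *m (x1 - x2))).
Proof.
have [h0 h0_gt0 H] := psiV_drift; exists h0 => // x1 x2 h h_ge0 hh0.
by have [lam [lam0 lam1 ->]] := increment_in_conv f A x1 x2 f_diff f_conv; exact: H.
Qed.

Lemma Dplus_psiV (x1 x2 : 'cV[R]_n) (w1 w2 : 'cV[R]_nw) : 0 < eta_z ->
  Dplus (fun x => psiV V x / eta_z) (x1 - x2) (f x1 - f x2 + B *m (w1 - w2))
    <= - norm1 (C *m (x1 - x2)) + eta_w / eta_z * norm1 (w1 - w2).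
Proof.
move=> eta_z_gt0.
have [h0 h0_gt0 H] := psiV_euler.
apply: (@Dplus_le _ _ _ _ _ _ _ _ h0) => //.
- by move=> x y; rewrite -mulrDl ler_pM2r ?invr_gt0 // psiV_subadditive.
- by move=> h x h_ge0; rewrite mulrA ler_pM2r ?invr_gt0 // psiVZ_le.
move=> h h_gt0 hh0.
rewrite ler_pdivrMr // scalerDr addrA scalemxAr.
apply: le_trans (psiV_subadditive V V0 _ _) _.
apply: le_trans (lerD (H _ _ _ (ltW h_gt0) hh0) (psiV_input _)) _.
rewrite norm1Z (gtr0_norm h_gt0) le_eqVlt; apply/orP; left; apply/eqP.
by field; rewrite gt_eqF.
Qed.

End Dissipation.

(** * Continuity and local integrability on the half-line *)

Section HalflineContinuity.
Context {R : realType}.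
Notation mu := (@lebesgue_measure R).

Lemma halfline_ge0 (t : R) : halfline R t = (0 <= t) :> Prop.
Proof. by rewrite /halfline /= in_itv /= andbT. Qed.

Lemma within_halfline_dist {V : normedModType R} (y : R -> V) (c eps : R) :
  {within halfline R, continuous y} -> 0 <= c -> 0 < eps ->
  exists2 d : R, 0 < d &
    forall s, 0 <= s -> `|s - c| < d -> `|y s - y c| < eps.
Proof.
move=> /subspace_continuousP yc c0 eps0.
have /cvgr_dist_lt /(_ eps eps0) : y x @[x --> within (halfline R) (nbhs c)] --> y c.
  by apply: yc; rewrite halfline_ge0.
rewrite near_withinE => /nbhs_ballP[d /= d0 H]; exists d => // s s0 sc.
rewrite distrC; apply: H; last by rewrite halfline_ge0.
by rewrite -ball_normE /= distrC.
Qed.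

Lemma within_continuous_cV {n : nat} (D : set R) (y : R -> 'cV[R]_n) :
  (forall i, {within D, continuous (fun t => y t i 0)}) -> {within D, continuous y}.
Proof.
move=> yc t; apply/cvg_ballP => e e0; near=> s; split => // i j.
rewrite (ord1 j); move: i; near: s; apply: filter_forall => {}i.
by apply: cvg_ball e0; exact: yc.
Unshelve. all: by end_near. Qed.

(** Continuity at [c] is taken from the compact interval [[0, c + 1]], which agrees with the
    half-line near [c]. *)
Lemma within_continuous_Rintegral (g : R -> R) :
  (forall t, 0 <= t -> mu.-integrable `[0, t] (EFin \o g)) ->
  {within halfline R, continuous (fun t => \int[mu]_(s in `[0, t]) g s)}.
Proof.
move=> ig; apply/subspace_continuousP => c; rewrite halfline_ge0 => c0.
have c1 : 0 <= c + 1 by rewrite addr_ge0.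
have /subspace_continuousP H := parameterized_integral_continuous c1 (ig _ c1).
have cin : `[0, c + 1]%classic c by rewrite /= in_itv /= c0 lerDl ler01.
apply: cvg_trans (H c cin); apply: cvg_app => A HA.
have sc : \forall s \near c, s <= c + 1 by apply: lt_le_nbhsl; rewrite ltrDl.
change (nbhs c [set s | halfline R s -> A s]).
have {}HA : nbhs c [set s | `[0, c + 1]%classic s -> A s] := HA.
apply: filterS2 HA sc => s HAs sc; rewrite /mkset halfline_ge0 => s0.
by apply: HAs; rewrite /= in_itv /= s0.
Qed.

Lemma within_halfline_integrable (g : R -> R) (t : R) :
  {within halfline R, continuous g} -> mu.-integrable `[0, t] (EFin \o g).
Proof.
move=> gc; apply: continuous_compact_integrable; first exact: segment_compact.
apply: continuous_subspaceW gc => s /=.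
by rewrite in_itv /= halfline_ge0 => /andP[].
Qed.

Lemma within_continuous_norm1_mul {n p : nat} (C : 'M[R]_(p, n)) (D : set R)
    (y : R -> 'cV[R]_n) :
  {within D, continuous y} -> {within D, continuous (fun t => norm1 (C *m y t))}.
Proof.
move=> yc.
have Ci i : continuous (fun x : 'cV[R]_n => (C *m x) i 0).
  have -> : (fun x : 'cV[R]_n => (C *m x) i 0) = fun x => \sum_j C i j * x j 0.
    by apply/funext => x; rewrite mxE.
  apply: continuous_big => [|j _]; first exact: add_continuous.
  by move=> x; apply: continuousM; [exact: cst_continuous|exact: coord_continuous].
have H : continuous (fun x : 'cV[R]_n => norm1 (C *m x)).
  apply: continuous_big => [|i _]; first exact: add_continuous.
  by move=> x; apply: continuous_comp; [exact: Ci|exact: norm_continuous].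
apply: (within_continuous_comp D y (fun x => norm1 (C *m x)) _ yc) => x _.
exact: H.
Qed.

End HalflineContinuity.

(** * Real-valued integrals over bounded intervals *)

Lemma Rintegral_sum d (T : measurableType d) (R : realType)
    (mu : {measure set T -> \bar R}) (I : finType) (D : set T) (F : I -> T -> R) :
  measurable D -> (forall i, mu.-integrable D (EFin \o F i)) ->
  \int[mu]_(s in D) (\sum_i F i s) = \sum_i \int[mu]_(s in D) F i s.
Proof.
move=> mD iF; rewrite /Rintegral.
under eq_integral do rewrite -sumEFin.
rewrite (integral_sum mD iF) -sum_fine // => i _.
exact: integrable_fin_num.
Qed.

Section RealIntegral.
Context {R : realType}.
Notation mu := (@lebesgue_measure R).

Lemma Rintegral_itv0B (g : R -> R) (a b : R) :
  mu.-integrable `[0, b] (EFin \o g) -> 0 <= a -> a <= b ->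
  \int[mu]_(s in `[0, b]) g s - \int[mu]_(s in `[0, a]) g s =
  \int[mu]_(s in `]a, b]) g s.
Proof. by move=> ig a0 ab; rewrite Rintegral_itvB // bnd_simp. Qed.

Lemma integrable_itv_oc (g : R -> R) (a b : R) : 0 <= a ->
  mu.-integrable `[0, b] (EFin \o g) -> mu.-integrable `]a, b] (EFin \o g).
Proof.
move=> a0; apply: integrableS => // s /=; rewrite !in_itv /= => /andP[as_ ->].
by rewrite andbT (le_trans a0) // ltW.
Qed.

Lemma Rintegral_oc_cst (a b c : R) : a <= b ->
  \int[mu]_(_ in `]a, b]) c = c * (b - a).
Proof.
rewrite le_eqVlt => /predU1P[->|ab].
  by rewrite set_itvoc0 Rintegral_set0 subrr mulr0.
rewrite Rintegral_cst //; congr (_ * _).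
have abE : lebesgue_measure (`]a, b]%classic : set R) = (b - a)%:E.
  by rewrite lebesgue_measure_itv /= lte_fin ab EFinB.
exact: (congr1 fine abE).
Qed.

End RealIntegral.

(** * The max norm, and passage from local to global bounds *)

Lemma mx_norm_entry_le {R : realType} {p q : nat} (x : 'M[R]_(p, q)) i j :
  `|x i j| <= `|x|.
Proof.
by rewrite /Num.norm /= mx_normrE; apply: (le_bigmax _ _ (i, j)).
Qed.

Lemma mx_norm_le {R : realType} {p q : nat} (x : 'M[R]_(p, q)) (c : R) :
  0 <= c -> (forall i j, `|x i j| <= c) -> `|x| <= c.
Proof.
by move=> c0 xc; rewrite /Num.norm /= mx_normrE; apply/bigmax_leP; split => // -[].
Qed.

(* The points t with Phi t - Phi 0 <= eps * t are closed under passing over their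
   supremum, so no continuity of Phi is needed. *)
Lemma straddle_le {R : realType} (Phi : R -> R) (T eps : R) : 0 <= T ->
  (forall c, 0 <= c -> c <= T -> exists2 d : R, 0 < d &
    forall a b, 0 <= a -> a <= c -> c <= b -> c - d < a -> b < c + d ->
      Phi b - Phi a <= eps * (b - a)) ->
  Phi T - Phi 0 <= eps * T.
Proof.
move=> T0 H.
pose S := [set t : R | 0 <= t <= T /\ Phi t - Phi 0 <= eps * t].
have S0 : S 0 by split; [rewrite lexx|rewrite subrr mulr0].
have supS : has_sup S.
  by split; [exists 0|exists T => t [/andP[]]].
pose c := sup S.
have c0 : 0 <= c by apply: ub_le_sup => //; case: supS.
have cT : c <= T by apply: ge_sup; [exists 0|move=> t [/andP[]]].
have [d d0 Hd] := H c c0 cT.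
have [a [/andP[a0 aT] aE] ca] := sup_adherent d0 supS.
have ac : a <= c by apply: ub_le_sup => //; [case: supS|split => //; exact/andP].
(* The bound from 0 to [a], valid as [a] is in [S], plus the local bound from [a] to [b] across
   [c]. *)
have step b : c <= b -> b <= T -> b < c + d -> S b.
  move=> cb bT bd; split; first by rewrite (le_trans c0 cb).
  by have := Hd a b a0 ac cb ca bd; lra.
have [cT'|Tc] := ltP c T; last first.
  have E : c = T by apply/le_anti; rewrite cT.
  by case: (step c (lexx _)) => //; [rewrite ltrDl|rewrite E].
(* If [c < T], this point of [S] lies strictly beyond the supremum [c]. *)
pose b := Num.min T (c + d / 2).
have cb : c < b by rewrite lt_min cT' ltrDl divr_gt0.
have : S b.
  apply: step; rewrite ?(ltW cb) ?ge_min ?lexx //.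
  by rewrite gt_min; apply/orP; right; rewrite ltrD2l ltr_pdivrMr // ltr_pMr // ltr1n.
by move=> /(ub_le_sup (proj2 supS)); rewrite leNgt cb.
Qed.

(** Monotone convergence along the intervals [[0, i + 1]]. *)
Lemma ge0_integral_halfline_le {R : realType} (g : R -> R) (c : \bar R) :
  (forall s, 0 <= g s) ->
  (forall T : R, 0 <= T -> (@lebesgue_measure R).-integrable `[0, T] (EFin \o g)) ->
  (forall T : R, 0 <= T ->
    (\int[@lebesgue_measure R]_(s in `[0%R, T]) (g s)%:E <= c)%E) ->
  (\int[@lebesgue_measure R]_(s in halfline R) (g s)%:E <= c)%E.
Proof.
move=> g0 ig gc.
have mg : measurable_fun (halfline R) g.
  rewrite /halfline itv0y_bigcup0S; apply/measurable_fun_bigcup => // i.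
  by apply/measurable_EFinP; apply: (measurable_int (@lebesgue_measure R)); exact: ig.
(* Extension by zero: [g] is known to be measurable on the half-line only, while
   [ge0_integral_ereal_sup] asks for measurability on the whole line. *)
pose g' := g \_ (halfline R).
have g'E s : s \in halfline R -> g' s = g s by move=> sD; rewrite /g' patchE sD.
have -> : (\int[@lebesgue_measure R]_(s in halfline R) (g s)%:E =
    \int[@lebesgue_measure R]_(s in halfline R) (g' s)%:E)%E.
  by apply: eq_integral => s sD; rewrite g'E.
rewrite /halfline (@ge0_integral_ereal_sup _ _ g').
- apply: ge_ereal_sup => _ [i _ <-].
  have -> : (\int[@lebesgue_measure R]_(s in `[0%R, i.+1%:R]) (g' s)%:E =
      \int[@lebesgue_measure R]_(s in `[0%R, i.+1%:R]) (g s)%:E)%E; last exact: gc.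
  apply: eq_integral => s; rewrite inE /= in_itv /= => /andP[s0 _].
  by rewrite g'E // inE halfline_ge0.
- by move=> s; rewrite /g' patchE; case: ifP.
- have mD : measurable (halfline R) by exact: measurable_itv.
  exact: (proj1 (measurable_restrictT _ mD) mg).
Qed.

(** On the half-line each coordinate equals an integral with variable upper limit; the values of [x]
    at negative times are unconstrained. *)
Lemma is_solution_continuous {R : realType} {n nw : nat} (f : 'cV[R]_n -> 'cV[R]_n)
    (B : 'M[R]_(n, nw)) (w : R -> 'cV[R]_nw) (x : R -> 'cV[R]_n) :
  is_solution f B w x -> {within halfline R, continuous x}.
Proof.
move=> sol; apply: within_continuous_cV => i.
have Ic : {within halfline R, continuous
    (fun t => \int[@lebesgue_measure R]_(s in `[0, t]) (f (x s) + B *m w s) i 0)}.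
  by apply: within_continuous_Rintegral => t t0; have [] := sol t t0 i.
apply: subspace_eq_continuous Ic => t; rewrite inE halfline_ge0 => t0.
exact: esym (proj2 (sol t t0 i)).
Qed.

(** * The difference of two solutions over a short interval *)

Section Gain.
Context {R : realType} {n nw nz : nat}.
Notation mu := (@lebesgue_measure R).
Variables (f : 'cV[R]_n -> 'cV[R]_n) (B : 'M[R]_(n, nw)) (C : 'M[R]_(nz, n)).
Variables (w1 w2 : R -> 'cV[R]_nw) (x1 x2 : R -> 'cV[R]_n).
Hypothesis f_cont : continuous f.
Hypothesis w1_meas : forall i, measurable_fun (halfline R) (fun t => w1 t i 0).
Hypothesis w2_meas : forall i, measurable_fun (halfline R) (fun t => w2 t i 0).
Hypothesis sol1 : is_solution f B w1 x1.
Hypothesis sol2 : is_solution f B w2 x2.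
Hypothesis w_fin : (\int[mu]_(t in halfline R) (norm1 (w1 t - w2 t))%:E < +oo)%E.

Let e t := x1 t - x2 t.
Let d t := f (x1 t) - f (x2 t).
Let w t := w1 t - w2 t.

Let e_cont : {within halfline R, continuous e}.
Proof.
exact: (within_continuousB (is_solution_continuous _ _ _ _ sol1)
  (is_solution_continuous _ _ _ _ sol2)).
Qed.

Let d_cont : {within halfline R, continuous d}.
Proof.
have fx (x : R -> 'cV[R]_n) w' : is_solution f B w' x ->
    {within halfline R, continuous (f \o x)}.
  move=> /is_solution_continuous xc.
  by apply: within_continuous_comp xc => y _; exact: f_cont.
exact: (within_continuousB (fx _ _ sol1) (fx _ _ sol2)).
Qed.

Let d_coord_cont i : {within halfline R, continuous (fun t => d t i 0)}.
Proof.
apply: (within_continuous_comp _ d (fun x : 'cV[R]_n => x i 0) _ d_cont) => y _.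
exact: coord_continuous.
Qed.

Let w_meas j : measurable_fun (halfline R) (fun t => w t j 0).
Proof.
rewrite (_ : (fun t => w t j 0) = (fun t => w1 t j 0) \- (fun t => w2 t j 0)).
  by apply: measurable_funB; [exact: w1_meas|exact: w2_meas].
by apply/funext => t; rewrite /w !mxE.
Qed.

Let norm1_w_meas : measurable_fun (halfline R) (fun t => norm1 (w t)).
Proof.
apply: measurable_sum => j.
by apply: (measurableT_comp (@normr_measurable R setT)); exact: w_meas.
Qed.

Let norm1_w_integrable_halfline : mu.-integrable (halfline R) (EFin \o (fun t => norm1 (w t))).
Proof.
apply/integrableP; split; first exact/measurable_EFinP.
under eq_integral do rewrite /= ger0_norm ?norm1_ge0 //.
exact: w_fin.
Qed.

Let subset_halfline T : `[0, T]%classic `<=` halfline R.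
Proof. by move=> s; rewrite halfline_ge0 /= in_itv /= => /andP[]. Qed.

Let norm1_w_integrable T : mu.-integrable `[0, T] (EFin \o (fun t => norm1 (w t))).
Proof.
apply: integrableS norm1_w_integrable_halfline => //; exact: measurable_itv.
Qed.

Let w_integrable T j : mu.-integrable `[0, T] (EFin \o (fun t => w t j 0)).
Proof.
apply: le_integrable (norm1_w_integrable T) => //.
  by apply/measurable_EFinP; apply: measurable_funS (w_meas j) => //; exact: measurable_itv.
move=> t _ /=; rewrite lee_fin (ger0_norm (norm1_ge0 _)) /norm1 (bigD1 j) //=.
by rewrite lerDl sumr_ge0.
Qed.

Let u a b : 'cV[R]_nw := \col_j \int[mu]_(s in `]a, b]) w s j 0.
(** The error of freezing the drift difference [d] at the left endpoint. *)
Let r a b : 'cV[R]_n := \col_i \int[mu]_(s in `]a, b]) (d s i 0 - d a i 0).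

Lemma solution_increment a b : 0 <= a -> a <= b ->
  e b = e a + (b - a) *: d a + r a b + B *m u a b.
Proof.
move=> a0 ab; have b0 := le_trans a0 ab.
apply/matrixP => i j; rewrite (ord1 j) {j}.
have [i1b e1b] := sol1 b b0 i; have [_ e1a] := sol1 a a0 i.
have [i2b e2b] := sol2 b b0 i; have [_ e2a] := sol2 a a0 i.
have E1 := Rintegral_itv0B _ _ _ i1b a0 ab; rewrite -e1b -e1a in E1.
have E2 := Rintegral_itv0B _ _ _ i2b a0 ab; rewrite -e2b -e2a in E2.
have id : mu.-integrable `]a, b] (EFin \o (fun s => d s i 0)).
  by apply: integrable_itv_oc => //; exact: within_halfline_integrable.
have ic c : mu.-integrable `]a, b] (EFin \o (fun=> c)).
  apply: integrable_itv_oc => //; apply: within_halfline_integrable.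
  by apply: continuous_subspaceT => ?; exact: cst_continuous.
have iw j : mu.-integrable `]a, b] (EFin \o (fun s => w s j 0)).
  exact: integrable_itv_oc.
have iBw j : mu.-integrable `]a, b] (EFin \o (fun s => B i j * w s j 0)).
  exact: (integrableZl _ _ (iw j)).
have idc : mu.-integrable `]a, b] (EFin \o (fun s => d s i 0 - d a i 0)).
  exact: (integrableB _ id (ic _)).
(* For each solution only the sum [f x + B w] is known to be integrable. The solutions are therefore
   subtracted first: [d] is integrable by continuity and [w1 - w2] by [w_fin], so the difference can
   be split. *)
have : e b i 0 - e a i 0 = \int[mu]_(s in `]a, b])
    ((d s i 0 - d a i 0) + d a i 0 + \sum_j B i j * w s j 0).
  transitivity ((x1 b i 0 - x1 a i 0) - (x2 b i 0 - x2 a i 0)).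
    by rewrite /e !mxE; ring.
  rewrite E1 E2 -RintegralB //; [|exact: integrable_itv_oc..].
  apply: eq_Rintegral => s _; rewrite subrK /d !mxE opprD addrACA; congr (_ + _).
  by rewrite -sumrB; apply: eq_bigr => j _; rewrite /w !mxE mulrBr.
rewrite RintegralD //; last 2 first.
- exact: (integrableD _ idc (ic _)).
- rewrite (_ : EFin \o _ = (fun s => \sum_j (B i j * w s j 0)%:E)%E).
    exact: (integrable_sum _ _ (fun j _ => iBw j)).
  by apply/funext => s /=; rewrite sumEFin.
rewrite RintegralD // Rintegral_oc_cst // Rintegral_sum // => E.
have -> : (e a + (b - a) *: d a + r a b + B *m u a b) i 0 =
    e a i 0 + (b - a) * d a i 0 + r a b i 0 + (B *m u a b) i 0.
  do 2 (rewrite mxE; congr (_ + _)); rewrite mxE; congr (_ + _); by rewrite mxE.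
rewrite -[LHS](subrK (e a i 0)) E [r a b i 0]mxE [(B *m _) i 0]mxE.
have -> : \sum_j B i j * u a b j 0 = \sum_j \int[mu]_(s in `]a, b]) (B i j * w s j 0).
  by apply: eq_bigr => j _; rewrite mxE RintegralZl.
by ring.
Qed.

Lemma norm1_u_le a b : 0 <= a -> a <= b ->
  norm1 (u a b) <= \int[mu]_(s in `]a, b]) norm1 (w s).
Proof.
move=> a0 ab; have iw j : mu.-integrable `]a, b] (EFin \o (fun s => w s j 0)).
  exact: integrable_itv_oc.
rewrite /norm1 Rintegral_sum //; last by move=> j; exact: integrable_norm.
by apply: ler_sum => j _; rewrite mxE; exact: le_normr_Rintegral.
Qed.

Lemma norm_r_le a b eps : 0 <= eps -> 0 <= a -> a <= b ->
  (forall s, a < s -> s <= b -> `|d s - d a| <= eps) ->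
  `|r a b| <= eps * (b - a).
Proof.
move=> eps0 a0 ab deps.
apply: mx_norm_le => [|i j]; first by rewrite mulr_ge0 // subr_ge0.
have ic c : mu.-integrable `]a, b] (EFin \o (fun=> c)).
  apply: integrable_itv_oc => //; apply: within_halfline_integrable.
  by apply: continuous_subspaceT => ?; exact: cst_continuous.
have id : mu.-integrable `]a, b] (EFin \o (fun s => d s i 0)).
  by apply: integrable_itv_oc => //; exact: within_halfline_integrable.
have idc : mu.-integrable `]a, b] (EFin \o (fun s => d s i 0 - d a i 0)).
  exact: (integrableB _ id (ic _)).
rewrite (ord1 j) mxE; apply: le_trans (le_normr_Rintegral _ idc) _ => //.
rewrite -Rintegral_oc_cst //; apply: le_Rintegral => //; first exact: integrable_norm.
move=> s /=; rewrite in_itv /= => /andP[as_ sb].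
apply: le_trans (deps s as_ sb).
by have := mx_norm_entry_le (d s - d a) i 0; rewrite !mxE.
Qed.


(** * Storage balance along two solutions, for an abstract gauge [psi] *)

Variables (psi : 'cV[R]_n -> R) (eta_w eta_z L h0 : R).
Hypothesis psi_ge0 : forall x, 0 <= psi x.
Hypothesis psi0 : psi 0 = 0.
Hypothesis psiD : forall x y, psi (x + y) <= psi x + psi y.
Hypothesis L_gt0 : 0 < L.
Hypothesis psi_le_norm : forall x, psi x <= L * `|x|.
Hypothesis eta_w_ge0 : 0 <= eta_w.
Hypothesis eta_z_gt0 : 0 < eta_z.
Hypothesis h0_gt0 : 0 < h0.
Hypothesis psi_euler : forall (y1 y2 : 'cV[R]_n) h, 0 <= h -> h <= h0 ->
  psi (y1 - y2 + h *: (f y1 - f y2)) <= psi (y1 - y2) - h * (eta_z * norm1 (C *m (y1 - y2))).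
Hypothesis psi_input : forall v : 'cV[R]_nw, psi (B *m v) <= eta_w * norm1 v.

Let z t := norm1 (C *m e t).

Let z_cont : {within halfline R, continuous z}.
Proof. exact: within_continuous_norm1_mul. Qed.

(** Stored amount plus weighted output minus weighted input up to time [t]; the gain bound amounts
    to [Phi] staying nonpositive. *)
Let Phi t := psi (e t) + eta_z * (\int[mu]_(s in `[0, t]) z s)
  - eta_w * (\int[mu]_(s in `[0, t]) norm1 (w s)).

(** The Euler step lowers [psi] by [(b - a) eta_z z(a)], which offsets the output integral up to
    [eta_z eps (b - a)]. The input terms cancel, and the remainder [r] costs at most
    [L eps (b - a)]. *)
Lemma storage_increment_le a b eps : 0 <= eps -> 0 <= a -> a <= b -> b - a <= h0 ->
  (forall s, a < s -> s <= b -> `|d s - d a| <= eps) ->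
  (forall s, a < s -> s <= b -> z s <= z a + eps) ->
  Phi b - Phi a <= eps * (L + eta_z) * (b - a).
Proof.
move=> eps0 a0 ab bah0 deps zeps.
have ba0 : 0 <= b - a by rewrite subr_ge0.
have iz : mu.-integrable `[0, b] (EFin \o z) by exact: within_halfline_integrable.
have Ez := Rintegral_itv0B _ _ _ iz a0 ab.
have Ew := Rintegral_itv0B _ _ _ (norm1_w_integrable b) a0 ab.
have z_le : \int[mu]_(s in `]a, b]) z s <= (z a + eps) * (b - a).
  rewrite -Rintegral_oc_cst //; apply: le_Rintegral => //.
  - exact: integrable_itv_oc.
  - apply: integrable_itv_oc => //; apply: within_halfline_integrable.
    by apply: continuous_subspaceT => ?; exact: cst_continuous.
  - by move=> s /=; rewrite in_itv /= => /andP[]; exact: zeps.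
have e_le : psi (e b) <= psi (e a) - (b - a) * (eta_z * z a)
    + L * (eps * (b - a)) + eta_w * \int[mu]_(s in `]a, b]) norm1 (w s).
  rewrite (solution_increment _ _ a0 ab).
  apply: le_trans (psiD _ _) _; apply: lerD.
    apply: le_trans (psiD _ _) _; apply: lerD; first exact: psi_euler.
    apply: le_trans (psi_le_norm _) _.
    by rewrite ler_wpM2l ?(ltW L_gt0) // norm_r_le.
  apply: le_trans (psi_input _) _.
  by rewrite ler_wpM2l // norm1_u_le.
have := ler_wpM2l (ltW eta_z_gt0) z_le; rewrite -Ez => z_le'.
rewrite -Ew in e_le.
rewrite /Phi; lra.
Qed.

Lemma storage_le0 T : 0 <= T -> Phi T <= 0.
Proof.
move=> T0.
have Phi0 : Phi 0 = 0.
  have e0 : e 0 = 0.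
    apply/matrixP => i j; rewrite (ord1 j).
    have [_ E1] := sol1 0 (lexx _) i; have [_ E2] := sol2 0 (lexx _) i.
    by rewrite /e [LHS]mxE [X in _ + X]mxE E1 E2 set_itv1 !Rintegral_set1 subrr mxE.
  by rewrite /Phi e0 psi0 set_itv1 !Rintegral_set1 !mulr0 addr0 subr0.
have Lz : 0 < L + eta_z by rewrite addr_gt0.
(* It suffices to bound [Phi T] by every [eps > 0]; the growth rate [eps / (T + 1)] also covers
   [T = 0]. *)
apply/ler_addgt0Pr => eps eps0; rewrite add0r -[Phi T]subr0 -Phi0.
have T1 : 0 < T + 1 by rewrite ltr_wpDl.
apply: (@le_trans _ _ (eps / (T + 1) * T)); last first.
  by rewrite mulrAC ler_pdivrMr // ler_pM2l // lerDl.
(* Halved because [s] and [a] are each compared with [c], giving an oscillation of at most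
   [eta + eta]. *)
pose eta := eps / (T + 1) / (L + eta_z) / 2.
have eta0 : 0 < eta by rewrite !divr_gt0.
apply: straddle_le => // c c0 cT.
have [d1 d1_gt0 Hd] := within_halfline_dist _ _ _ d_cont c0 eta0.
have [d2 d2_gt0 Hz] := within_halfline_dist _ _ _ z_cont c0 eta0.
(* With both endpoints within [h0 / 2] of [c], the step [b - a] is at most [h0]. *)
exists (Num.min (Num.min d1 d2) (h0 / 2)); first by rewrite !lt_min d1_gt0 d2_gt0 divr_gt0.
set D := Num.min _ _ => a b a0 ac cb ca bc.
have D1 : D <= d1 by rewrite !ge_min lexx.
have D2 : D <= d2 by rewrite !ge_min lexx orbT.
have D3 : D <= h0 / 2 by rewrite !ge_min lexx !orbT.
have near_c s : a <= s -> s <= b -> [/\ 0 <= s, `|s - c| < d1 & `|s - c| < d2].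
  by move=> as_ sb; rewrite !ltr_norml; split; lra.
have [_ ad1 ad2] := near_c a (lexx _) (le_trans ac cb).
have := Hd a a0 ad1; have := Hz a a0 ad2 => za da.
apply: le_trans (@storage_increment_le a b (eta + eta) _ a0 (le_trans ac cb) _ _ _) _.
- by rewrite addr_ge0 // ltW.
- lra.
- move=> s /ltW as_ sb; have [s0 sd1 _] := near_c s as_ sb.
  apply: le_trans (ler_distD (d c) _ _) _; rewrite [`|d c - d a|]distrC.
  by apply: lerD; apply: ltW => //; exact: Hd.
- move=> s /ltW as_ sb; have [s0 _ sd2] := near_c s as_ sb.
  have := Hz s s0 sd2; move: za; rewrite !ltr_norml => /andP[? ?] /andP[? ?]; lra.
rewrite le_eqVlt; apply/orP; left; apply/eqP; rewrite /eta.
by field; rewrite !gt_eqF.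
Qed.

(** Dropping [psi (e T) >= 0] from [Phi T <= 0] gives the estimate on [[0, T]]. The input integral
    is enlarged to the half-line, and then [T] tends to infinity. *)
Lemma L1_gain_le :
  (\int[mu]_(t in halfline R) (norm1 (C *m x1 t - C *m x2 t))%:E <=
    (eta_w / eta_z)%:E * \int[mu]_(t in halfline R) (norm1 (w1 t - w2 t))%:E)%E.
Proof.
have zE t : norm1 (C *m x1 t - C *m x2 t) = z t by rewrite /z /e mulmxBr.
under eq_integral do rewrite zE.
apply: ge0_integral_halfline_le => [s|T T0|T T0]; first exact: norm1_ge0.
  exact: within_halfline_integrable.
have iz : mu.-integrable `[0, T] (EFin \o z) by exact: within_halfline_integrable.
have EFin_Rint (g : R -> R) : mu.-integrable `[0, T] (EFin \o g) ->
    (\int[mu]_(s in `[0%R, T]) (g s)%:E = (\int[mu]_(s in `[0, T]) g s)%:E)%E.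
  by move=> ig; rewrite /Rintegral fineK //; exact: integrable_fin_num.
apply: (@le_trans _ _ ((eta_w / eta_z)%:E * \int[mu]_(s in `[0%R, T]) (norm1 (w s))%:E)%E).
  rewrite !EFin_Rint // -EFinM lee_fin mulrAC ler_pdivlMr // mulrC.
  have aux (p I J : R) : 0 <= p -> p + I - J <= 0 -> I <= J by lra.
  exact: aux (psi_ge0 _) (storage_le0 T T0).
apply: lee_wpmul2l; first by rewrite lee_fin divr_ge0 // ltW.
apply: ge0_subset_integral => //; first exact: measurable_itv.
  exact/measurable_EFinP.
by move=> s _; rewrite lee_fin norm1_ge0.
Qed.

End Gain.

(** * Specialization to the gauge [psiV], with either sign of [eta_w] *)

Theorem theorem1 (R : realType) (n nw nz m k : nat)
  (f : 'cV[R]_n -> 'cV[R]_n) (B : 'M[R]_(n, nw)) (C : 'M[R]_(nz, n))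
  (A : 'I_k -> 'M[R]_n)
  (eta_w eta_z : R) (V : 'M[R]_(n, m)) (P : 'M[R]_(m, nw + nw))
  (M : 'I_k -> 'M[R]_m) :
  C1 f ->
  (forall x, in_conv A (Jac f x)) ->
  (* (i) *)
  (forall j l, 0 <= P j l) ->
  row_mx B (- B) = V *m P ->
  eta_w *: (const_mx 1 : 'rV[R]_(nw + nw)) = (const_mx 1 : 'rV[R]_m) *m P ->
  (* (ii) *)
  0 < eta_z ->
  (forall i : 'I_k, forall j l : 'I_m, j != l -> 0 <= M i j l) ->
  (forall i : 'I_k, A i *m V = V *m M i) ->
  (forall i : 'I_k,
     - eta_z *: (\row_(j < m) norm1 (C *m col j V)) = (const_mx 1 : 'rV[R]_m) *m M i) ->
  (* conv of the columns of V is compact with 0 in its interior *)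
  compact (conv_cols V) ->
  interior (conv_cols V) 0 ->
  let psi := fun x => psiV V x / eta_z in
  let gamma1 := eta_w / eta_z in
  (forall (x1 x2 : 'cV[R]_n) (w1 w2 : 'cV[R]_nw),
     Dplus psi (x1 - x2) (f x1 - f x2 + B *m (w1 - w2))
       <= - norm1 (C *m (x1 - x2)) + gamma1 * norm1 (w1 - w2))
  /\
  (forall (w1 w2 : R -> 'cV[R]_nw) (x1 x2 : R -> 'cV[R]_n),
     (forall i : 'I_nw, measurable_fun (halfline R) (fun t => w1 t i 0)) ->
     (forall i : 'I_nw, measurable_fun (halfline R) (fun t => w2 t i 0)) ->
     is_solution f B w1 x1 -> is_solution f B w2 x2 ->
     (\int[@lebesgue_measure R]_(t in (halfline R))
          (norm1 (w1 t - w2 t))%:E < +oo)%E ->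
     (\int[@lebesgue_measure R]_(t in (halfline R))
          (norm1 (C *m x1 t - C *m x2 t))%:E
      <= (eta_w / eta_z)%:E *
         \int[@lebesgue_measure R]_(t in (halfline R))
          (norm1 (w1 t - w2 t))%:E)%E).
Proof.
move=> [f_diff _] f_conv P_ge0 BVP PE eta_z_gt0 M_ge0 AVM ME _ V0 psi gamma1.
have eta_z_ge0 := ltW eta_z_gt0.
split=> [y1 y2 v1 v2|w1 w2 x1 x2 w1_meas w2_meas sol1 sol2 w_fin].
  exact: (@Dplus_psiV _ _ _ _ _ _ f B C A eta_w eta_z V P M).
have [h0 h0_gt0 euler] :=
  @psiV_euler _ _ _ _ _ f C A eta_z V M M_ge0 AVM ME eta_z_ge0 V0 f_diff f_conv.
have [L L_gt0 psi_le_norm] := psiV_le_norm V V0.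
(* Stated for any nonnegative rate [eta], so that it can also be used with [eta = 0] when [eta_w] is
   negative. *)
have gain eta : 0 <= eta -> (forall v, psiV V (B *m v) <= eta * norm1 v) ->
    (\int[@lebesgue_measure R]_(t in halfline R) (norm1 (C *m x1 t - C *m x2 t))%:E <=
      (eta / eta_z)%:E *
      \int[@lebesgue_measure R]_(t in halfline R) (norm1 (w1 t - w2 t))%:E)%E.
  move=> eta_ge0 input.
  apply: (@L1_gain_le _ _ _ _ f B C w1 w2 x1 x2 _ w1_meas w2_meas sol1 sol2 w_fin
    (psiV V) eta eta_z L h0) => //.
  - by move=> x; apply: differentiable_continuous; exact: f_diff.
  - exact: psiV_ge0.
  - exact: psiV0.
  - exact: psiV_subadditive.
have input := @psiV_input _ _ _ _ B eta_w V P P_ge0 BVP PE.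
(* A negative eta_w is possible only when nw = 0. *)
have norm1_w_eq0 (v : 'cV[R]_nw) : eta_w < 0 -> norm1 v = 0.
  move=> eta_w0; apply/le_anti; rewrite norm1_ge0 andbT -(nmulr_rge0 _ eta_w0).
  exact: le_trans (psiV_ge0 V V0 _) (input v).
have [eta_w_ge0|eta_w0] := leP 0 eta_w; first exact: gain.
have I0 : (\int[@lebesgue_measure R]_(t in halfline R) (norm1 (w1 t - w2 t))%:E = 0)%E.
  by apply: integral0_eq => t _; rewrite norm1_w_eq0.
(* The input integral vanishes, so the bounds with rates 0 and [eta_w] coincide; rate 0 is
   admissible because [norm1 v = 0] for every [v]. *)
have := gain 0 (lexx _); rewrite I0 !mule0; apply => v.
by rewrite mul0r -(mulr0 eta_w) -(norm1_w_eq0 v eta_w0) input.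
Qed.
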